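(* Let $\pi_0$ be an irreducible representation of $G(V_0)$, $\tau$ an irreducible representation of $\mathrm{GL}_{\mathbb E}(X)$, and $\rho=\mathrm{Ind}_P^{G(V)}(\tau\boxtimes\pi_0)$ (possibly reducible). If $\chi^{1+q}\ne1$, then the operator $J(\rho,\chi)=|\mathfrak g_V|^{-1/2}\sum_{g\in G^0(V),\,\det(\mathrm{id}+g)\ne0}\chi(\det(\mathrm{id}_V+g))\rho(g)$ is a scalar operator on $\rho$.
   Context: Let $\mathbb F$ be a finite field of odd cardinality $q$, $\mathbb E/\mathbb F$ of degree $1$ or $2$ with Galois generator $x\mapsto\bar x$; $\mathcal C$ algebraically closed of characteristic not dividing $q$, with fixed $\sqrt q$. $(V,\langle\cdot,\cdot\rangle_V)$ is an $\epsilon$-sesquilinear space over $\mathbb E$ ($\mathbb E$-linear in the first variable, $\langle y,x\rangle=\epsilon_V\overline{\langle x,y\rangle}$, $\epsilon_V=1$ if $\mathbb E\neq\mathbb F$), nondegenerate or with zero form; $G(V)$ its isometry group, $\mathfrak g_V$ its Lie algebra $\{A:\langle Ax,y\rangle+\langle x,Ay\rangle=0\}$; $G^0(V)=\{\det=1\}$ if $\mathbb E=\mathbb F$, $\epsilon_V=1$, nondegenerate, else $G^0(V)=G(V)$. For $\chi:\mathbb E^\times\to\mathcal C^\times$, $\chi^{1+q}(x)=\chi(x\bar x)$. Parabolic setup: if the form is nondegenerate, $V=X\oplus V_0\oplus Y$ with $X,Y$ totally isotropic in duality, $V_0=(X\oplus Y)^\perp$, and $P$ the stabilizer in $G(V)$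 of $0\subset X\subset X\oplus V_0\subset V$ (Levi $\mathrm{GL}(X)\times G(V_0)$); if the form is zero, $V=X\oplus V_0$ and $P$ the stabilizer of $X$ in $\mathrm{GL}(V)$ (Levi $\mathrm{GL}(X)\times\mathrm{GL}(V_0)$). $\mathrm{Ind}$ denotes parabolic induction. *)

(* Defs.v *)
From HB Require Import structures.
From mathcomp Require Import all_boot all_order all_algebra.
From mathcomp Require Import mxtens.
Set Implicit Arguments.
Unset Strict Implicit.
Unset Printing Implicit Defensive.
Import GRing.Theory.
Local Open Scope ring_scope.

Section ClassicalGroups.
Variables (E : finFieldType) (sigma : {rmorphism E -> E}).

Definition fixedF : {set E} := [set x : E | sigma x == x].
Definition qF : nat := #|fixedF|.
Definition E_is_F : bool := [forall x : E, sigma x == x].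

Variable n : nat.
(* <x,y> = x^T B sigma(y) on column vectors; eps : bool encodes (-1)^eps *)
Definition sesq_form (eps : bool) (B : 'M[E]_n) : Prop :=
  B^T = (-1) ^+ eps *: map_mx sigma B.

Definition isom_grp (B : 'M[E]_n) : {set 'M[E]_n} :=
  [set g : 'M[E]_n | (g \in unitmx) && (g^T *m B *m map_mx sigma g == B)].

Definition lie_alg (B : 'M[E]_n) : {set 'M[E]_n} :=
  [set A : 'M[E]_n | A^T *m B + B *m map_mx sigma A == 0].

Definition isom0_grp (eps : bool) (B : 'M[E]_n) : {set 'M[E]_n} :=
  if [&& E_is_F, ~~ eps & B \in unitmx]
  then [set g in isom_grp B | \det g == 1]
  else isom_grp B.
End ClassicalGroups.

Definition GL_set (E : finFieldType) (k : nat) : {set 'M[E]_k} :=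
  [set a : 'M[E]_k | a \in unitmx].

Section Reps.
Variables (E : finFieldType) (C : fieldType) (n : nat).

Definition is_rep d (G : {set 'M[E]_n}) (rho : 'M[E]_n -> 'M[C]_d) : Prop :=
  rho 1%:M = 1%:M /\ {in G &, forall g h, rho (g *m h) = rho g *m rho h}.

(* irreducible: nonzero, and no G-stable column subspace other than 0, C^d *)
Definition irr_rep d (G : {set 'M[E]_n}) (rho : 'M[E]_n -> 'M[C]_d) : Prop :=
  [/\ is_rep G rho, (0 < d)%N &
      forall W : 'M[C]_d,
        (forall g, g \in G -> exists Z : 'M[C]_d, rho g *m W = W *m Z) ->
        W = 0 \/ W \in unitmx].

Definition left_transversal r (G P : {set 'M[E]_n}) (t : 'I_r -> 'M[E]_n) :=
  (forall i, t i \in G) /\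
  (forall g, g \in G -> exists! i, invmx (t i) *m g \in P).

Definition ind_rep d r (P : {set 'M[E]_n}) (s : 'M[E]_n -> 'M[C]_d)
    (t : 'I_r -> 'M[E]_n) (g : 'M[E]_n) : 'M[C]_(r * d) :=
  \sum_(i < r) \sum_(j < r)
     tensmx (delta_mx i j : 'M[C]_r)
       (let p := invmx (t i) *m g *m t j in if p \in P then s p else 0).
End Reps.

(* the operator J(rho, chi) = |g_V|^{-1/2} sum_{g in G^0, det(1+g)<>0} chi(det(1+g)) rho(g),
   with |g_V|^{-1/2} := sq^-(log_q |g_V|), sq a fixed square root of q *)
Definition J_op (E : finFieldType) (sigma : {rmorphism E -> E}) (C : fieldType)
    (sq : C) (chi : E -> C) (eps : bool) n (B : 'M[E]_n) D
    (rho : 'M[E]_n -> 'M[C]_D) : 'M[C]_D :=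
  (sq ^- trunc_log (qF sigma) #|lie_alg sigma B|) *:
  \sum_(g in isom0_grp sigma eps B | \det (1%:M + g) != 0)
     chi (\det (1%:M + g)) *: rho g.

Section NonDeg.
Variables (E : finFieldType) (sigma : {rmorphism E -> E}) (eps : bool) (k m : nat).

(* Gram matrix of V in a basis adapted to X (+) V0 (+) Y: X, Y totally isotropic,
   paired by Cxy, and V0 = (X (+) Y)^perp with Gram matrix B0 *)
Definition form_nd (Cxy : 'M[E]_k) (B0 : 'M[E]_m) : 'M[E]_(k + m + k) :=
  block_mx (block_mx 0 0 0 B0) (col_mx Cxy 0)
           (row_mx ((-1) ^+ eps *: (map_mx sigma Cxy)^T) 0) 0.

(* stabilizer in G(V) of the flag 0 < X < X (+) V0 < V *)
Definition parab_nd (B : 'M[E]_(k + m + k)) : {set 'M[E]_(k + m + k)} :=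
  [set g in isom_grp sigma B | (dlsubmx g == 0) && (dlsubmx (ulsubmx g) == 0)].

(* tau (x) pi0 inflated to P through the Levi quotient P -> GL(X) x G(V0) *)
Definition infl_nd (C : comPzRingType) dt dp (tau : 'M[E]_k -> 'M[C]_dt)
    (pi0 : 'M[E]_m -> 'M[C]_dp) (g : 'M[E]_(k + m + k)) : 'M[C]_(dt * dp) :=
  tensmx (tau (ulsubmx (ulsubmx g))) (pi0 (drsubmx (ulsubmx g))).
End NonDeg.

(* ---- zero form case: V = X (+) V0, coordinates k | m ---- *)
Section ZeroForm.
Variables (E : finFieldType) (sigma : {rmorphism E -> E}) (k m : nat).

(* stabilizer of X in GL(V) = G(V) *)
Definition parab_z : {set 'M[E]_(k + m)} :=
  [set g in isom_grp sigma (0 : 'M[E]_(k + m)) | dlsubmx g == 0].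

Definition infl_z (C : comPzRingType) dt dp (tau : 'M[E]_k -> 'M[C]_dt)
    (pi0 : 'M[E]_m -> 'M[C]_dp) (g : 'M[E]_(k + m)) : 'M[C]_(dt * dp) :=
  tensmx (tau (ulsubmx g)) (pi0 (drsubmx g)).
End ZeroForm.

(* Main.v *)
(* The coefficients of [J(rho, chi)] form a class function [Phi] on [G = G(V)], and
   [N] (the unipotent radical of [P]) acts trivially on the inducing representation,
   so [J] is block diagonal for the decomposition of [rho] along [G / P] as soon as
   [sum_(u in N) Phi (g u) = 0] for every [g] outside [P]; the diagonal blocks commute
   with the irreducible Levi representation and are scalar by Schur's lemma.

   As [det (1 + g u) = det (u^-1 + g)], the vanishing follows from a bijection
   [s |-> s'] of [N] with [det (s' + g) = lam (sigma lam) det (s + g)] and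
   [chi (lam * sigma lam) <> 1]. Since [g] does not stabilise [X], there is a vector
   [v] outside [X^perp] with [v + g v] in [X^perp], and [x0] in [X] with [<x0, v> = 1].
   The vectors [(x0, 0)] and [(v, g v)] span a hyperbolic plane of [V (+) V^-]; the
   torus of this plane preserves the graph of [g] and permutes the graphs of [- s],
   [s] in [N]. For the zero form a transvection-like column operation plays the same
   role, with [lam * sigma lam] replaced by any scalar. *)
Require Import Defs.
From HB Require Import structures.
From mathcomp Require Import all_boot all_order all_algebra.
From mathcomp Require Import mxtens ring.
Set Implicit Arguments.
Unset Strict Implicit.
Unset Printing Implicit Defensive.
Import GRing.Theory.
Local Open Scope ring_scope.

(** * Linear algebra: rank-one perturbations and kernels not stable under a matrix *)

Lemma mulmx_col_inj (R : pzRingType) m n (A B : 'M[R]_(m, n)) :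
  (forall u : 'cV_n, A *m u = B *m u) -> A = B.
Proof.
move=> AB; apply/matrixP=> i j.
by have /colP/(_ i) := AB (delta_mx j 0); rewrite -!colE !mxE.
Qed.

(** Both determinants equal that of the block matrix with rows [(1, u)] and [(- w, 1)], which has
    two triangular factorizations. *)
Lemma det1Dmul (R : comPzRingType) n (u : 'cV[R]_n) (w : 'rV[R]_n) :
  \det (1%:M + u *m w) = 1 + (w *m u) 0 0.
Proof.
have E1 : block_mx (1%:M + u *m w) u 0 1%:M *m block_mx 1%:M 0 (- w) 1%:M
   = block_mx 1%:M 0 (- w) 1%:M *m block_mx 1%:M u 0 (1%:M + w *m u).
  rewrite !mulmx_block !mulmx1 !mul1mx !mul0mx !mulmx0 !add0r !addr0.
  by rewrite mulmxN addrK mulNmx [1%:M + _]addrC addKr.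
have := congr1 determinant E1.
rewrite !det_mulmx !det_ublock !det_lblock !det1 !mulr1 !mul1r => ->.
by rewrite [w *m u]mx11_scalar det_mx11 !mxE eqxx mulr1n.
Qed.

(** If the row space of [A] lies in that of [A (1 + g)], the two agree by rank, so [A g] factors
    through [A] and [g] stabilises the kernel of [A]. Otherwise some vector is killed by [A (1 + g)]
    but not by [A]; a column of the cokernel matrix provides it. *)
Lemma unstable_kernel_witness (F : fieldType) k n (A : 'M[F]_(k, n)) (g : 'M_n) :
  (exists Z, A *m g = Z *m A) \/
  (exists v : 'cV_n, A *m (v + g *m v) = 0 /\ A *m v != 0).
Proof.
have [sAB|] := boolP (A <= A *m (1%:M + g))%MS.
  left; have := mxrank_leqif_sup sAB; case=> le_rk; rewrite eqn_leq le_rk /=.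
  rewrite mxrankM_maxl => /esym/submxP[Z] /eqP.
  rewrite mulmxDr mulmx1 addrC eq_sym -subr_eq => /eqP <-.
  by exists (Z - 1%:M); rewrite mulmxBl mul1mx.
rewrite submxE => nz; right.
have /existsP[j Aj] : [exists j, col j (A *m cokermx (A *m (1%:M + g))) != 0].
  rewrite -negb_forall; apply: contra nz => /forallP z.
  apply/eqP/matrixP=> i j; have /eqP/colP/(_ i) := z j.
  by rewrite mxE => ->; rewrite !mxE.
exists (col j (cokermx (A *m (1%:M + g)))); rewrite !colE in Aj *.
split; last by rewrite mulmxA.
set u := _ *m delta_mx j 0; rewrite -{1}[u]mul1mx -mulmxDl /u 2!mulmxA.
by rewrite mulmx_coker mul0mx.
Qed.

(** * Finite matrix groups and reindexing of sums over them *)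

Section MatrixGroups.
Variables (E : finFieldType) (n : nat).

Definition mx_group (G : {set 'M[E]_n}) : Prop :=
  [/\ 1%:M \in G, {in G, forall g, g \in unitmx} &
      {in G &, forall g h, g *m h \in G}].

Variables (G : {set 'M[E]_n}).
Hypothesis gG : mx_group G.

Lemma mx_group_mull_inj g : g \in G -> injective (mulmx g : 'M_n -> 'M_n).
Proof.
case: gG => _ uG _ /uG ug h1 h2 eq_h.
by rewrite -[h1](mulKmx ug) eq_h mulKmx.
Qed.

Lemma mx_group_mull_onto g : g \in G -> [set g *m h | h in G] = G.
Proof.
case: gG => _ _ mG Gg; apply/eqP.
rewrite eqEcard card_imset ?leqnn ?andbT; last exact: mx_group_mull_inj.
by apply/subsetP=> _ /imsetP[h Gh ->]; exact: mG.
Qed.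

Lemma mx_group_inv g : g \in G -> invmx g \in G.
Proof.
move=> Gg; have [G1 uG mG] := gG.
have : 1%:M \in [set g *m h | h in G] by rewrite mx_group_mull_onto.
case/imsetP=> h Gh E1; suff -> : invmx g = h by [].
by rewrite -[h](mulKmx (uG _ Gg)) -E1 mulmx1.
Qed.

Lemma mx_groupMl g h : g \in G -> (g *m h \in G) = (h \in G).
Proof.
move=> Gg; have [G1 uG mG] := gG; apply/idP/idP; last exact: mG.
by move=> Ggh; rewrite -[h](mulKmx (uG _ Gg)) mG ?mx_group_inv.
Qed.

Lemma mx_groupMr g h : g \in G -> (h *m g \in G) = (h \in G).
Proof.
move=> Gg; have [G1 uG mG] := gG; apply/idP/idP; last by move=> Gh; exact: mG.
by move=> Ggh; rewrite -[h](mulmxK (uG _ Gg)) mG ?mx_group_inv.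
Qed.

Lemma sum_mx_groupMl (V : nmodType) (f : 'M_n -> V) g : g \in G ->
  \sum_(h in G) f (g *m h) = \sum_(h in G) f h.
Proof.
move=> Gg; rewrite [RHS](reindex_inj (mx_group_mull_inj Gg)) /=.
by apply: eq_bigl => h; rewrite mx_groupMl.
Qed.

Lemma invmx_inj : injective (@invmx E n).
Proof. exact: can_inj (@invmxK _ _). Qed.

Lemma sum_mx_groupV (V : nmodType) (f : 'M_n -> V) :
  \sum_(h in G) f (invmx h) = \sum_(h in G) f h.
Proof.
rewrite [RHS](reindex_inj invmx_inj) /=; apply: eq_bigl => h.
by apply/idP/idP=> /mx_group_inv; rewrite ?invmxK.
Qed.

Lemma sum_mx_groupMr (V : nmodType) (f : 'M_n -> V) g : g \in G ->
  \sum_(h in G) f (h *m g) = \sum_(h in G) f h.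
Proof.
move=> Gg; have [_ uG _] := gG.
rewrite [RHS](reindex_inj (can_inj (mulmxK (uG _ Gg)))) /=.
by apply: eq_bigl => h; rewrite mx_groupMr.
Qed.
End MatrixGroups.

(** * Class functions acting on an induced representation *)

Section InducedRepresentation.
Variables (E : finFieldType) (C : fieldType) (n d r : nat).
Variables (G P N : {set 'M[E]_n}) (Phi : 'M[E]_n -> C).
Variables (s : 'M[E]_n -> 'M[C]_d) (t : 'I_r -> 'M[E]_n).
Hypotheses (gG : mx_group G) (gP : mx_group P) (gN : mx_group N).
Hypotheses (sPG : P \subset G) (sNP : N \subset P).
Hypothesis Phi_class : {in G &, forall g h, Phi (h *m g *m invmx h) = Phi g}.
Hypothesis s_rep : is_rep P s.
Hypothesis s_triv : {in N, forall u, s u = 1%:M}.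
Hypothesis Phi_cusp :
  {in G, forall g, g \notin P -> \sum_(u in N) Phi (g *m u) = 0}.

(** Cut [P] into cosets [p N]. On each of them [s] is constant, and the remaining sum of [Phi] over
    [g p N] vanishes because [g p] is again outside [P]. *)
Lemma sum_parabolic_coset0 g : g \in G -> g \notin P ->
  \sum_(p in P) Phi (g *m p) *: s p = 0.
Proof.
move=> Gg nPg; have [_ uP mP] := gP; have [N1 uN mN] := gN.
pose cos p : {set 'M_n} := [set p *m u | u in N].
rewrite (partition_big cos predT) //=; apply: big1 => K _.
have [/existsP[p0 /andP[Pp0 /eqP <-]]|/existsPn no] :=
  boolP [exists p, (p \in P) && (cos p == K)]; last first.
  by rewrite big_pred0 // => p; exact/negbTE.
have memc p : (p \in P) && (cos p == cos p0) = (p \in cos p0).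
  apply/andP/imsetP=> [[Pp /eqP eq_c]|[u Nu ->]].
    have : p \in cos p0 by rewrite -eq_c; apply/imsetP; exists 1%:M; rewrite ?mulmx1.
    by case/imsetP=> u Nu ->; exists u.
  split; first by rewrite mP // (subsetP sNP).
  apply/eqP/setP=> x; apply/imsetP/imsetP=> [[w Nw ->]|[w Nw ->]].
    by exists (u *m w); rewrite ?mulmxA // mN.
  exists (invmx u *m w); first by rewrite mN // (mx_group_inv gN).
  by rewrite -mulmxA mulKVmx // uN.
rewrite (eq_bigl _ _ memc) big_imset /=; last first.
  by move=> u w _ _; exact: (mx_group_mull_inj gP).
rewrite (eq_bigr (fun u => Phi (g *m p0 *m u) *: s p0)); last first.
  move=> u Nu; have [_ sM] := s_rep.
  by rewrite sM ?(subsetP sNP u) // (s_triv Nu) mulmx1 mulmxA.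
rewrite -scaler_suml Phi_cusp ?scale0r //.
  by have [_ _ mG] := gG; rewrite mG // (subsetP sPG).
by rewrite (mx_groupMr gP).
Qed.

Hypothesis s_commutant :
  forall T, {in P, forall p, T *m s p = s p *m T} -> exists a, T = a%:M.

(** Invariance of [Phi] under conjugation by [P] makes the sum commute with every [s p]. *)
Lemma sum_parabolic_scalar : exists a, \sum_(p in P) Phi p *: s p = a%:M.
Proof.
apply: s_commutant => p Pp; have [s1 sM] := s_rep; have [P1 uP mP] := gP.
have Pi := mx_group_inv gP Pp.
rewrite mulmx_suml mulmx_sumr -(sum_mx_groupMr gP _ Pi).
rewrite -(sum_mx_groupMl gP _ Pp); apply: eq_bigr => h Ph.
rewrite -scalemxAl -scalemxAr Phi_class ?(subsetP sPG) //; congr (_ *: _).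
by rewrite -!sM ?mP // mulmxKV ?uP.
Qed.

Hypothesis t_trans : left_transversal G P t.

(** Substituting [g = t_i p t_j^-1] turns block [(i, j)] into a sum over [P] of
    [Phi (t_j^-1 t_i p) *: s p]. For distinct [i] and [j] transversality puts [t_j^-1 t_i] outside
    [P], so the block is zero; every diagonal block is the same scalar. *)
Lemma sum_ind_rep_scalar :
  exists a, \sum_(g in G) Phi g *: ind_rep P s t g = a%:M.
Proof.
have [a Ea] := sum_parabolic_scalar; exists a.
have [Gt tU] := t_trans; have [_ uG mG] := gG; have [P1 uP mP] := gP.
pose blk i j : 'M[C]_d := \sum_(g in G) Phi g *:
  (let p := invmx (t i) *m g *m t j in if p \in P then s p else 0).
have blkE i j : blk i j = if i == j then a%:M else 0.
  have -> : blk i j = \sum_(p in P) Phi (invmx (t j) *m t i *m p) *: s p.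
    have Gi := Gt i; have Gj := Gt j; have Gvj := mx_group_inv gG Gj.
    rewrite /blk -(sum_mx_groupMr gG _ Gvj).
    rewrite -(sum_mx_groupMl gG _ Gi).
    rewrite (big_setID P) /= (setIidPr sPG) [X in _ + X]big1 ?addr0; last first.
      move=> p /setDP[_ /negbTE nPp].
      rewrite !mulmxA mulVmx ?uG // mul1mx mulmxKV ?uG //.
      by rewrite nPp scaler0.
    apply: eq_bigr => p Pp.
    rewrite !mulmxA mulVmx ?uG // mul1mx mulmxKV ?uG // Pp; congr (_ *: _).
    have Gx : invmx (t j) *m t i *m p \in G by rewrite !mG ?(subsetP sPG p).
    rewrite -(Phi_class Gx Gj).
    by rewrite !mulmxA mulmxV ?uG // mul1mx.
  have [<-|neq] := eqVneq.
    by rewrite mulVmx ?uG // -Ea; apply: eq_bigr => p; rewrite mul1mx.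
  apply: sum_parabolic_coset0; first by rewrite mG // (mx_group_inv gG).
  apply: contra neq => Pij; have [i0 [_ i0U]] := tU _ (Gt i).
  by rewrite -(i0U i) ?mulVmx ?uG // -(i0U j).
have -> : \sum_(g in G) Phi g *: ind_rep P s t g =
    \sum_(i < r) \sum_(j < r) tensmx (delta_mx i j : 'M[C]_r) (blk i j).
  rewrite /ind_rep /blk.
  under eq_bigr => g _ do rewrite scaler_sumr.
  rewrite [LHS]exchange_big; apply: eq_bigr => i _ /=.
  under eq_bigr => g _ do rewrite scaler_sumr.
  rewrite [LHS]exchange_big; apply: eq_bigr => j _ /=.
  apply/matrixP=> x y; case: (mxtens_indexP x) => x1 x2; case: (mxtens_indexP y) => y1 y2.
  rewrite tensmxE summxE summxE mulr_sumr; apply: eq_bigr => g _.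
  by rewrite [LHS]mxE tensmxE mulrCA; congr (_ * _); rewrite [RHS]mxE.
apply/matrixP=> x y; case: (mxtens_indexP x) => x1 x2; case: (mxtens_indexP y) => y1 y2.
rewrite summxE (bigD1 x1) //= [X in _ + X]big1 ?addr0 => [|i ne_ix]; last first.
  rewrite summxE big1 // => j _.
  by rewrite tensmxE mxE eq_sym (negbTE ne_ix) mul0r.
rewrite summxE (bigD1 x1) //= [X in _ + X]big1 ?addr0 => [|j ne_jx]; last first.
  by rewrite blkE eq_sym (negbTE ne_jx) tensmx0 mxE.
rewrite tensmxE blkE eqxx !mxE eqxx (can_eq (@mxtens_indexK _ _)) xpair_eqE eq_sym /=.
by case: (x1 == y1); rewrite ?mul1r ?mul0r.
Qed.
End InducedRepresentation.

(** * Schur's lemma, for one group and for an external tensor product *)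

Lemma sum_mxtens (V : nmodType) m n (F : 'I_(m * n) -> V) :
  \sum_k F k = \sum_i \sum_j F (mxtens_index (i, j)).
Proof.
rewrite (reindex (@mxtens_index m n)) /=.
  by rewrite (pair_bigA _ (fun i j => F (mxtens_index (i, j)))); apply: eq_bigr => -[].
by exists (@mxtens_unindex m n) => x _; rewrite ?mxtens_indexK ?mxtens_unindexK.
Qed.

Section Schur.
Variables (E : finFieldType) (C : closedFieldType).

(** For an eigenvalue [a] of [T], the image of [T - a] is stable, so [T - a] is zero or invertible;
    the eigenvector rules out the second. *)
Lemma irr_rep_commutant n d (G : {set 'M[E]_n}) (rho : 'M[E]_n -> 'M[C]_d) T :
  irr_rep G rho -> {in G, forall g, T *m rho g = rho g *m T} ->
  exists a, T = a%:M.
Proof.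
case=> _ d_gt0 irr cT.
have /closed_rootP[a] : size (char_poly T) != 1%N.
  by rewrite size_char_poly eqSS -lt0n.
rewrite -eigenvalue_root_char => /eigenvalueP[v vT v_neq0]; exists a.
have [g Gg|/eqP|uW] := irr (T - a%:M).
- by exists (rho g); rewrite mulmxBl mulmxBr cT // scalar_mxC.
- by rewrite subr_eq0 => /eqP.
case/eqP: v_neq0; rewrite -[v](mulmxK uW) mulmxBr vT.
by rewrite mul_mx_scalar subrr mul0mx.
Qed.

(** Commuting with [tau a] tensor [1] makes each [dt]-by-[dt] block of [T] scalar, so [T] is [1]
    tensor [c]; commuting with [1] tensor [pi b] then makes [c] scalar. *)
Lemma tens_irr_commutant k m dt dp (A : {set 'M[E]_k}) (B : {set 'M[E]_m})
    (tau : 'M[E]_k -> 'M[C]_dt) (pi : 'M[E]_m -> 'M[C]_dp) T :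
  irr_rep A tau -> irr_rep B pi -> 1%:M \in A -> 1%:M \in B ->
  {in A & B, forall a b,
     T *m tensmx (tau a) (pi b) = tensmx (tau a) (pi b) *m T} ->
  exists c, T = c%:M.
Proof.
move=> irrA irrB A1 B1 cT.
have [[tau1 _] dt_gt0 _] := irrA; have [[pi1 _] _ _] := irrB.
pose blk j j' : 'M[C]_dt :=
  \matrix_(i, i') T (mxtens_index (i, j)) (mxtens_index (i', j')).
have blk_scal j j' : exists c, blk j j' = c%:M.
  apply: (irr_rep_commutant irrA) => a Aa; have := cT a _ Aa B1.
  rewrite pi1 => /matrixP cTa; apply/matrixP=> i i'.
  have := cTa (mxtens_index (i, j)) (mxtens_index (i', j')).
  rewrite !mxE !sum_mxtens => eqT; apply: etrans (etrans eqT _); [symmetry|].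
    apply: eq_bigr => x _; rewrite (bigD1 j') //= big1 => [|y /negbTE ne].
      by rewrite tensmxE !mxE eqxx mulr1 addr0.
    by rewrite tensmxE [1%:M _ _]mxE ne !mulr0.
  apply: eq_bigr => x _; rewrite (bigD1 j) //= big1 => [|y /negbTE ne].
    by rewrite tensmxE !mxE eqxx mulr1 addr0.
  by rewrite tensmxE [1%:M _ _]mxE eq_sym ne mulr0 mul0r.
pose i0 := Ordinal dt_gt0; pose c : 'M[C]_dp := \matrix_(j, j') blk j j' i0 i0.
have defT : T = tensmx 1%:M c.
  apply/matrixP=> x y; case: (mxtens_indexP x) => i j.
  case: (mxtens_indexP y) => i' j'; rewrite tensmxE !mxE.
  have [a /matrixP defa] := blk_scal j j'; have := defa i i'; have := defa i0 i0.
  by rewrite !mxE eqxx mulr1n => -> ->; rewrite -mulr_natl.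
have [z defc] : exists z, c = z%:M.
  apply: (irr_rep_commutant irrB) => b Bb; have := cT _ _ A1 Bb.
  rewrite defT tau1 !tensmx_mul !mulmx1 => /matrixP eqT; apply/matrixP=> j j'.
  have := eqT (mxtens_index (i0, j)) (mxtens_index (i0, j')).
  by rewrite !tensmxE mxE eqxx !mul1r.
exists z; rewrite defT defc; apply/matrixP=> x y.
case: (mxtens_indexP x) => i j; case: (mxtens_indexP y) => i' j'.
rewrite tensmxE !mxE (can_eq (@mxtens_indexK _ _)) xpair_eqE.
by case: eqP; rewrite ?mul1r ?mul0r.
Qed.
End Schur.

(** * The coefficients of [J] and the vanishing criterion for their sums *)

Section CharacterSums.
Variables (E : finFieldType) (sigma : {rmorphism E -> E}) (C : fieldType).
Variables (chi : E -> C) (eps : bool).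
Hypothesis chiM : forall x y, x != 0 -> y != 0 -> chi (x * y) = chi x * chi y.

(** Extension by zero absorbs the condition [det (1 + g) != 0], so that sums can run over full
    cosets. *)
Definition chi0 (x : E) : C := if x != 0 then chi x else 0.

Lemma chi0M c x : c != 0 -> chi0 (c * x) = chi c * chi0 x.
Proof.
move=> c0; rewrite /chi0 mulf_eq0 (negbTE c0) /=.
by case: eqP => [_|/eqP x0]; rewrite ?mulr0 // chiM.
Qed.

Lemma isom_grpP n (B g : 'M[E]_n) : reflect
  (g \in unitmx /\ g^T *m B *m map_mx sigma g = B) (g \in isom_grp sigma B).
Proof. by rewrite inE; apply: (iffP andP) => -[ug /eqP]. Qed.

Lemma isom_grp_group n (B : 'M[E]_n) : mx_group (isom_grp sigma B).
Proof.
split=> [|g /isom_grpP[]//|g h /isom_grpP[ug eg] /isom_grpP[uh eh]].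
  by apply/isom_grpP; rewrite unitmx1 trmx1 map_mx1 mulmx1 mul1mx.
apply/isom_grpP; rewrite unitmx_mul ug uh; split=> //.
by rewrite trmx_mul map_mxM !mulmxA -2!(mulmxA h^T) eg eh.
Qed.

Variables (n : nat) (B : 'M[E]_n).
Let G := isom_grp sigma B.

(** Also extended by zero from [G^0] to [G], where it is a class function. *)
Definition J_coef (g : 'M[E]_n) : C :=
  if g \in isom0_grp sigma eps B then chi0 (\det (1%:M + g)) else 0.

Lemma isom0_grpE g : g \in isom0_grp sigma eps B =
  (g \in G) && ([&& E_is_F sigma, ~~ eps & B \in unitmx] ==> (\det g == 1)).
Proof.
by rewrite /isom0_grp; case: ifP => _; rewrite ?andbT // [LHS]inE.
Qed.

Lemma J_opE (sq : C) D (rho : 'M[E]_n -> 'M[C]_D) :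
  J_op sigma sq chi eps B rho = sq ^- trunc_log (qF sigma) #|lie_alg sigma B| *:
    \sum_(g in G) J_coef g *: rho g.
Proof.
rewrite /J_op; congr (_ *: _); rewrite [RHS](big_setID (isom0_grp sigma eps B)) /=.
rewrite [X in _ + X]big1 ?addr0 => [|g /setDP[_ /negbTE n0]]; last first.
  by rewrite /J_coef n0 scale0r.
have -> : G :&: isom0_grp sigma eps B = isom0_grp sigma eps B.
  by apply/setIidPr/subsetP=> g; rewrite isom0_grpE => /andP[].
rewrite big_mkcondr; apply: eq_bigr => g G0g; rewrite /J_coef G0g /chi0.
by case: ifP => // _; rewrite scale0r.
Qed.

Lemma J_coef_class : {in G &, forall g h, J_coef (h *m g *m invmx h) = J_coef g}.
Proof.
have gG := isom_grp_group B; move=> g h Gg Gh.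
have [_ uG mG] := gG; have uh := uG _ Gh.
have detJ x : \det (h *m x *m invmx h) = \det x.
  by rewrite !det_mulmx det_inv mulrAC divff ?mul1r // -unitfE -unitmxE.
rewrite /J_coef !isom0_grpE detJ Gg !mG ?(mx_group_inv gG) //=.
by rewrite -[X in _ (\det (X + _))](mulmxV uh) -{1}[h]mulmx1 -mulmxDl -mulmxDr detJ.
Qed.

(** As [det u = 1] on [N], the coset [g N] lies inside [G^0] or misses it. In the first case
    [1 + g u = (u^-1 + g) u], and [N] is reindexed by inversion. *)
Lemma sum_J_coef_translate (N : {set 'M[E]_n}) g :
    mx_group N -> N \subset G -> {in N, forall u, \det u = 1} -> g \in G ->
  \sum_(u in N) chi0 (\det (u + g)) = 0 ->
  \sum_(u in N) J_coef (g *m u) = 0.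
Proof.
move=> gN sNG detN Gg sum0; have gG := isom_grp_group B.
have [_ uN _] := gN; have [_ _ mG] := gG.
have [G0g|nG0g] := boolP (g \in isom0_grp sigma eps B); last first.
  apply: big1 => u Nu; rewrite /J_coef isom0_grpE mx_groupMl // (subsetP sNG) //=.
  by move: nG0g; rewrite isom0_grpE Gg det_mulmx (detN _ Nu) mulr1 => /negbTE /= ->.
apply: etrans sum0; rewrite -[RHS](sum_mx_groupV gN); apply: eq_bigr => u Nu.
rewrite /J_coef isom0_grpE mG // ?(subsetP sNG u) //.
move: G0g; rewrite isom0_grpE Gg det_mulmx (detN _ Nu) mulr1 /= => ->.
have -> : 1%:M + g *m u = (invmx u + g) *m u by rewrite mulmxDl mulVmx ?uN.
by rewrite det_mulmx (detN _ Nu) mulr1.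
Qed.

(** Reindexing by [phi] multiplies the sum by [chi c], which differs from 1. *)
Lemma sum_chi0_twist (N : {set 'M[E]_n}) g (phi : 'M[E]_n -> 'M[E]_n) c :
    c != 0 -> chi c != 1 ->
    {in N, forall s, phi s \in N} -> {in N &, injective phi} ->
    {in N, forall s, \det (phi s + g) = c * \det (s + g)} ->
  \sum_(s in N) chi0 (\det (s + g)) = 0.
Proof.
move=> c0 chic phiN phi_inj det_phi.
have im_phi : [set phi s | s in N] = N.
  apply/eqP; rewrite eqEcard card_in_imset // leqnn andbT.
  by apply/subsetP=> _ /imsetP[s Ns ->]; exact: phiN.
have : \sum_(s in N) chi0 (\det (s + g)) = chi c * \sum_(s in N) chi0 (\det (s + g)).
  rewrite -{1}im_phi big_imset //= mulr_sumr; apply: eq_bigr => s Ns.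
  by rewrite det_phi // chi0M.
move/eqP; rewrite -subr_eq0 -{1}[\sum_(_ in _) _]mul1r -mulrBl mulf_eq0.
by rewrite subr_eq0 eq_sym (negbTE chic) => /eqP.
Qed.
End CharacterSums.

(** * Block triangular matrices *)

Lemma tensmx11 (R : pzRingType) m n :
  tensmx (1%:M : 'M[R]_m) (1%:M : 'M[R]_n) = 1%:M.
Proof.
apply/matrixP=> x y; case: (mxtens_indexP x) => i j.
case: (mxtens_indexP y) => i' j'.
rewrite tensmxE !mxE (can_eq (@mxtens_indexK _ _)) xpair_eqE.
by case: eqP; rewrite ?mul1r ?mul0r.
Qed.

Lemma mul_ublock (R : pzRingType) k m (p q : 'M[R]_(k + m)) :
  dlsubmx p = 0 -> dlsubmx q = 0 ->
  [/\ ulsubmx (p *m q) = ulsubmx p *m ulsubmx q, dlsubmx (p *m q) = 0 &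
      drsubmx (p *m q) = drsubmx p *m drsubmx q].
Proof.
move=> p0 q0; have -> : p *m q = block_mx (ulsubmx p *m ulsubmx q)
    (ulsubmx p *m ursubmx q + ursubmx p *m drsubmx q) 0 (drsubmx p *m drsubmx q).
  rewrite -{1}[p]submxK -{1}[q]submxK mulmx_block p0 q0.
  by rewrite !mul0mx !mulmx0 !addr0 !add0r.
by rewrite block_mxKul block_mxKdl block_mxKdr.
Qed.

Lemma det_dlsub0 (R : comPzRingType) k m (p : 'M[R]_(k + m)) :
  dlsubmx p = 0 -> \det p = \det (ulsubmx p) * \det (drsubmx p).
Proof. by move=> p0; rewrite -{1}[p]submxK p0 det_ublock. Qed.

Lemma unitmx_dlsub0 (F : fieldType) k m (p : 'M[F]_(k + m)) :
  dlsubmx p = 0 ->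
  (p \in unitmx) = (ulsubmx p \in unitmx) && (drsubmx p \in unitmx).
Proof. by move=> p0; rewrite !unitmxE det_dlsub0 // unitrM. Qed.

Lemma mulmx_row0_1 (R : pzRingType) k m n (v : 'M[R]_(k + m, n)) :
  row_mx (0 : 'M_(m, k)) 1%:M *m v = dsubmx v.
Proof. by rewrite -{1}[v]vsubmxK mul_row_col mul0mx mul1mx add0r. Qed.

Lemma dlsubmx_row0_1 (R : pzRingType) k m (g : 'M[R]_(k + m)) Z :
  row_mx (0 : 'M_(m, k)) 1%:M *m g = Z *m row_mx 0 1%:M -> dlsubmx g = 0.
Proof.
rewrite mulmx_row0_1 mul_mx_row mulmx0 mulmx1 => defg.
by rewrite /dlsubmx defg row_mxKl.
Qed.

Lemma blocks_mx1 (R : pzRingType) k m : [/\ ulsubmx (1%:M : 'M[R]_(k + m)) = 1%:M,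
  dlsubmx (1%:M : 'M[R]_(k + m)) = 0 & drsubmx (1%:M : 'M[R]_(k + m)) = 1%:M].
Proof. by rewrite scalar_mx_block block_mxKul block_mxKdl block_mxKdr. Qed.

Lemma exists_mulmx_eq (F : fieldType) n (u : 'cV[F]_n) (c : F) :
  u != 0 -> exists w : 'rV_n, (w *m u) 0 0 = c.
Proof.
move=> u0; have /existsP[j uj] : [exists j, u j 0 != 0].
  rewrite -negb_forall; apply: contra u0 => /forallP z.
  by apply/eqP/colP=> j; rewrite (eqP (z j)) mxE.
exists ((c / u j 0) *: delta_mx 0 j).
by rewrite -scalemxAl mxE -rowE mxE divfK.
Qed.

(** * The zero form: [G] is the full linear group *)

Section ZeroForm.
Variables (E : finFieldType) (sigma : {rmorphism E -> E}) (k m : nat).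
Local Notation G := (isom_grp sigma (0 : 'M[E]_(k + m))).
Local Notation P := (parab_z sigma k m).

Definition unip_z : {set 'M[E]_(k + m)} :=
  [set u in P | (ulsubmx u == 1%:M) && (drsubmx u == 1%:M)].

Lemma isom_grp0 n (g : 'M[E]_n) : (g \in isom_grp sigma 0) = (g \in unitmx).
Proof. by rewrite inE mulmx0 mul0mx eqxx andbT. Qed.

Lemma parab_zP p : reflect
  [/\ ulsubmx p \in unitmx, drsubmx p \in unitmx & dlsubmx p = 0] (p \in P).
Proof.
rewrite inE isom_grp0; apply: (iffP andP) => [[up /eqP p0]|[ua ub p0]].
  by move: up; rewrite unitmx_dlsub0 // => /andP[].
by rewrite unitmx_dlsub0 // ua ub p0.
Qed.

Lemma unip_zP u : reflect
  [/\ ulsubmx u = 1%:M, drsubmx u = 1%:M & dlsubmx u = 0] (u \in unip_z).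
Proof.
rewrite inE; apply: (iffP and3P) => [[/parab_zP[_ _ u0] /eqP ? /eqP ?]|[ul dr u0]] //.
by split; rewrite ?ul ?dr //; apply/parab_zP; rewrite ul dr !unitmx1.
Qed.

Lemma parab_z_group : mx_group P.
Proof.
have [u1 d1 e1] := blocks_mx1 E k m.
split=> [|p /parab_zP[ua ub p0]|p q /parab_zP[ua ub p0] /parab_zP[va vb q0]].
- by apply/parab_zP; rewrite u1 d1 e1 !unitmx1.
- by rewrite unitmx_dlsub0 // ua.
have [ul dl dr] := mul_ublock p0 q0.
by apply/parab_zP; rewrite ul dr dl !unitmx_mul ua ub va vb.
Qed.

Lemma unip_z_group : mx_group unip_z.
Proof.
have [u1 d1 e1] := blocks_mx1 E k m.
split=> [|p /unip_zP[ua ub p0]|p q /unip_zP[ua ub p0] /unip_zP[va vb q0]].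
- by apply/unip_zP; rewrite u1 d1 e1.
- by rewrite unitmx_dlsub0 // ua ub !unitmx1.
have [ul dl dr] := mul_ublock p0 q0.
by apply/unip_zP; rewrite ul dr dl ua ub va vb !mulmx1.
Qed.

Section Character.
Variables (C : fieldType) (chi : E -> C).
Hypothesis chiM : forall x y, x != 0 -> y != 0 -> chi (x * y) = chi x * chi y.
Variable c : E.
Hypotheses (c_neq0 : c != 0) (chi_c : chi c != 1).

Lemma sum_unip_z_chi0 g : g \in G -> g \notin P ->
  \sum_(s in unip_z) chi0 chi (\det (s + g)) = 0.
Proof.
move=> Gg nPg.
(* The row matrix [(0 1)] has kernel [X], so the witness [z] lies outside [X] while [z + g z] lies
   in [X]. *)
have [[Z /dlsubmx_row0_1 g0]|[z []]] :=
  unstable_kernel_witness (row_mx (0 : 'M_(m, k)) 1%:M) g.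
  by case/negP: nPg; rewrite inE Gg g0 eqxx.
rewrite !mulmx_row0_1 => gz0 z_neq0.
(* The value [c - 1] gives [R = 1 + z w] determinant [c], and the zero entries of [w] make it vanish
   on [X]. *)
have [w2 w2z] := exists_mulmx_eq (c - 1) z_neq0.
pose w : 'rV_(k + m) := row_mx 0 w2.
have wz : (w *m z) 0 0 = c - 1.
  by rewrite -[z]vsubmxK mul_row_col mul0mx add0r.
pose R : 'M_(k + m) := 1%:M + z *m w.
have detR : \det R = c by rewrite det1Dmul wz addrC subrK.
have uR : R \in unitmx by rewrite unitmxE detR unitfE.
(* Right multiplication of [s + g] by [R]. The correction [(s + g) z w] keeps [phi s] in the
   unipotent radical: [s z] is [z] modulo [X], so [(s + g) z] lies in [X], and [w] kills [X]. *)
pose phi (s : 'M[E]_(k + m)) := s + (s + g) *m z *m w.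
have phiE s : phi s + g = (s + g) *m R.
  by rewrite /phi /R mulmxDr mulmx1 mulmxA addrAC.
apply: (sum_chi0_twist chiM (phi := phi) c_neq0 chi_c) => [s|s1 s2 _ _|s _].
- case/unip_zP=> sul sdr sdl; apply/unip_zP.
  have sz : dsubmx ((s + g) *m z) = 0.
    rewrite mulmxDl linearD /= -{1}[s]submxK -{1}[z]vsubmxK mul_block_col.
    by rewrite col_mxKd sdl sdr mul0mx mul1mx add0r -linearD.
  rewrite /phi -[_ *m z]vsubmxK sz /w mul_col_row !mul0mx mulmx0.
  rewrite -[s]submxK add_block_mx block_mxKul block_mxKdl block_mxKdr.
  by rewrite !addr0 sul sdr sdl.
- move/(congr1 (+%R^~ g)); rewrite !phiE => /(can_inj (mulmxK uR)).
  exact: addIr.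
by rewrite phiE det_mulmx detR mulrC.
Qed.
End Character.

Lemma J_op_ind_scalar_z (C : closedFieldType) (sq : C) (chi : E -> C) eps c
    dt dp (tau : 'M[E]_k -> 'M[C]_dt) (pi0 : 'M[E]_m -> 'M[C]_dp)
    r (t : 'I_r -> 'M[E]_(k + m)) :
  (forall x y, x != 0 -> y != 0 -> chi (x * y) = chi x * chi y) ->
  c != 0 -> chi c != 1 ->
  irr_rep (GL_set E k) tau -> irr_rep (isom_grp sigma (0 : 'M[E]_m)) pi0 ->
  left_transversal G P t ->
  exists a : C, J_op sigma sq chi eps (0 : 'M[E]_(k + m))
    (ind_rep P (infl_z tau pi0) t) = a%:M.
Proof.
move=> chiM c0 chic irr_tau irr_pi t_trans.
have [[tau1 tauM] _ _] := irr_tau; have [[pi1 piM] _ _] := irr_pi.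
have [u1 d1 e1] := blocks_mx1 E k m.
have sPG : P \subset G by apply/subsetP=> p; rewrite inE => /andP[].
have sNP : unip_z \subset P by apply/subsetP=> p; rewrite inE => /andP[].
rewrite J_opE; have [||||a ->] := sum_ind_rep_scalar (s := infl_z tau pi0)
  (isom_grp_group sigma 0) parab_z_group unip_z_group sPG sNP
  (J_coef_class chi eps (B := 0)) _ _ _ _ t_trans.
- split; first by rewrite /infl_z u1 e1 tau1 pi1 tensmx11.
  move=> p q /parab_zP[ua ub p0] /parab_zP[va vb q0].
  have [ul dl dr] := mul_ublock p0 q0.
  by rewrite /infl_z ul dr tauM ?piM ?tensmx_mul ?isom_grp0 // inE.
- by move=> u /unip_zP[ul dr _]; rewrite /infl_z ul dr tau1 pi1 tensmx11.
- move=> g Gg nPg; apply: sum_J_coef_translate => //.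
  + exact: unip_z_group.
  + exact: subset_trans sNP sPG.
  + by move=> u /unip_zP[ul dr u0]; rewrite det_dlsub0 // ul dr !det1 mulr1.
  exact: sum_unip_z_chi0 chiM _ c0 chic _ Gg nPg.
- move=> T cT; apply: (tens_irr_commutant irr_tau irr_pi).
  + by rewrite inE unitmx1.
  + by rewrite isom_grp0 unitmx1.
  move=> a b; rewrite inE isom_grp0 => ua ub.
  have := cT (block_mx a 0 0 b); rewrite /infl_z block_mxKul block_mxKdr; apply.
  by apply/parab_zP; rewrite block_mxKul block_mxKdr block_mxKdl.
by eexists; rewrite scale_scalar_mx.
Qed.
End ZeroForm.

(** * Sesquilinear forms and the torus twist of an isometry *)

Section SesquilinearForm.
Variables (E : finFieldType) (sigma : {rmorphism E -> E}) (eps : bool).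
Variables (n : nat) (B : 'M[E]_n).
Hypothesis sigmaK : forall x, sigma (sigma x) = x.
Hypothesis symB : sesq_form sigma eps B.
Hypothesis unitB : B \in unitmx.

Definition sform (x y : 'cV[E]_n) : E := (x^T *m B *m map_mx sigma y) 0 0.

Lemma sformDl x x' y : sform (x + x') y = sform x y + sform x' y.
Proof. by rewrite /sform linearD /= !mulmxDl mxE. Qed.

Lemma sformZl a x y : sform (a *: x) y = a * sform x y.
Proof. by rewrite /sform linearZ /= -!scalemxAl mxE. Qed.

Lemma sformDr x y y' : sform x (y + y') = sform x y + sform x y'.
Proof. by rewrite /sform map_mxD mulmxDr mxE. Qed.

Lemma sformZr a x y : sform x (a *: y) = sigma a * sform x y.
Proof. by rewrite /sform map_mxZ -scalemxAr mxE. Qed.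

Lemma sformC x y : sform y x = (-1) ^+ eps * sigma (sform x y).
Proof.
have -> : sform y x = ((y^T *m B *m map_mx sigma x)^T) 0 0 by rewrite [RHS]mxE.
rewrite !trmx_mul trmxK symB mulmxA -scalemxAr -scalemxAl mxE; congr (_ * _).
have -> : sigma (sform x y) = map_mx sigma (x^T *m B *m map_mx sigma y) 0 0.
  by rewrite [RHS]mxE.
rewrite !map_mxM map_trmx; congr ((_ *m _) 0 0).
by apply/matrixP=> i j; rewrite !mxE sigmaK.
Qed.

(** The functional [x |-> <x, y>] as a row, so that [u *m sform_row y] is a rank-one operator to
    which [det1Dmul] applies. *)
Definition sform_row (y : 'cV[E]_n) : 'rV[E]_n := (B *m map_mx sigma y)^T.

Lemma sform_rowE x y : sform_row y *m x = (sform x y)%:M.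
Proof.
rewrite [LHS]mx11_scalar; congr (_%:M).
have -> : sform x y = (x^T *m B *m map_mx sigma y)^T 0 0 by rewrite [RHS]mxE.
by rewrite -mulmxA [(x^T *m _)^T]trmx_mul trmxK.
Qed.

Lemma mul_sform_row u y x : u *m sform_row y *m x = sform x y *: (u : 'cV_n).
Proof. by rewrite -mulmxA sform_rowE mul_mx_scalar. Qed.

Lemma isom_sform g x y :
  g \in isom_grp sigma B -> sform (g *m x) (g *m y) = sform x y.
Proof.
by case/isom_grpP=> _ eg; rewrite /sform -{2}eg trmx_mul map_mxM !mulmxA.
Qed.

Lemma sform_isom g :
  (forall x y, sform (g *m x) (g *m y) = sform x y) -> g \in isom_grp sigma B.
Proof.
move=> eg; suff eqB : g^T *m B *m map_mx sigma g = B.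
  apply/isom_grpP; split=> //; move: unitB.
  by rewrite -eqB !unitmx_mul unitmx_tr => /andP[/andP[]].
apply/matrixP=> i j.
have coefE (M : 'M[E]_n) : M i j = (delta_mx 0 i *m M *m delta_mx j 0 : 'M_1) 0 0.
  by rewrite -rowE -colE !mxE.
have := eg (delta_mx i 0) (delta_mx j 0).
by rewrite /sform trmx_mul !map_mxM map_delta_mx trmx_delta !coefE !mulmxA.
Qed.

Section Twist.
Variables (g : 'M[E]_n) (x0 v : 'cV[E]_n) (lam : E).
Hypothesis isom_g : g \in isom_grp sigma B.
Hypothesis lam_neq0 : lam != 0.
Hypotheses (x00 : sform x0 x0 = 0) (x0v : sform x0 v = 1).
Hypothesis x0gv : sform x0 (g *m v) = -1.

(* [twist] is the action on graphs, in [V (+) V^-], of the torus of a hyperbolic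
   plane spanned by [e = (x0, 0)] and the vector [f = (v, g v)] of the graph of
   [g]: the isometry [e |-> lam e], [f |-> (sigma lam)^-1 f] stabilises the graph
   of [g] and sends the graph of [- s] to that of [- twist s]. *)
Definition twist_coef : E := (-1) ^+ eps * ((sigma lam)^-1 - 1).

Definition twist_row (s : 'M[E]_n) : 'rV[E]_n :=
  (lam - 1) *: (sform_row v + sform_row (g *m v) *m s).

(** The torus element sends [(y, - s y)] to [(twist_den s y, - twist_num s y)]. Since [x0] is
    isotropic, the first component factors into two rank-one perturbations of the identity. *)
Definition twist_den (s : 'M[E]_n) : 'M[E]_n :=
  (1%:M + (twist_coef *: v) *m sform_row x0) *m (1%:M + x0 *m twist_row s).

Definition twist_num (s : 'M[E]_n) : 'M[E]_n :=
  s - (twist_coef *: (g *m v)) *m sform_row x0.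

Definition twist (s : 'M[E]_n) : 'M[E]_n := twist_num s *m invmx (twist_den s).

Local Notation alpha s y := ((lam - 1) * (sform y v + sform (s *m y) (g *m v))).
Local Notation sgn := ((-1) ^+ eps : E).

Let sgnK : sgn * sgn = 1. Proof. by rewrite -signr_addb addbb. Qed.
Let vx0 : sform v x0 = sgn. Proof. by rewrite sformC x0v rmorph1 mulr1. Qed.
Let siglam_neq0 : sigma lam != 0. Proof. by rewrite fmorph_eq0. Qed.

Lemma twist_rowE s y : twist_row s *m y = (alpha s y)%:M.
Proof.
by rewrite /twist_row -scalemxAl mulmxDl -mulmxA !sform_rowE -raddfD scale_scalar_mx.
Qed.

Lemma twist_denE s y : twist_den s *m y =
  y + alpha s y *: x0 + (twist_coef * sform y x0) *: v.
Proof.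
rewrite /twist_den -mulmxA mulmxDl mul1mx mul_sform_row mulmxDl mul1mx.
rewrite -mulmxA twist_rowE mul_mx_scalar sformDl sformZl x00 mulr0 addr0.
by rewrite scalerA [_ * twist_coef]mulrC.
Qed.

Lemma twist_numE s y :
  twist_num s *m y = s *m y - (twist_coef * sform y x0) *: (g *m v).
Proof. by rewrite mulmxBl mul_sform_row scalerA [_ * twist_coef]mulrC. Qed.

Section Isometry.
Variable s : 'M[E]_n.
Hypotheses (isom_s : s \in isom_grp sigma B) (s_x0 : s *m x0 = x0).

(** As [s] fixes [x0] and [<x0, v + g v> = 0], [twist_row s] kills [x0] and the second factor has
    determinant 1. The first contributes [1 + twist_coef * <v, x0>]. *)
Lemma det_twist_den : \det (twist_den s) = (sigma lam)^-1.
Proof.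
rewrite det_mulmx !det1Dmul twist_rowE s_x0 x0v x0gv subrr mulr0.
rewrite -scalemxAr sform_rowE vx0 !mxE eqxx !mulr1n addr0 mulr1.
by rewrite /twist_coef mulrAC sgnK mul1r addrC subrK.
Qed.

Lemma unit_twist_den : twist_den s \in unitmx.
Proof. by rewrite unitmxE det_twist_den unitfE invr_eq0. Qed.

Lemma twist_mul_den (y : 'cV_n) :
  twist s *m (twist_den s *m y) = twist_num s *m y.
Proof. by rewrite mulmxA mulmxKV // unit_twist_den. Qed.

(** The graph of [- s] is totally isotropic in [V (+) V^-], hence so is its image under the
    torus. *)
Lemma twist_sform y y' :
  sform (twist_num s *m y) (twist_num s *m y') =
  sform (twist_den s *m y) (twist_den s *m y').
Proof.
rewrite !twist_numE !twist_denE -!scaleNr.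
rewrite !(sformDl, sformDr, sformZl, sformZr) !isom_sform //.
(* Pairings with [y'] on the right are flipped into [sigma] of one standard order; after fixing the
   sign, a rational identity remains. *)
rewrite x00 x0v vx0 !(sformC y' x0, sformC y' v, sformC (s *m y') (g *m v)).
rewrite !(rmorphN, rmorphM, rmorphD, rmorphB, rmorph1, rmorph_sign, fmorphV, sigmaK).
rewrite /twist_coef; have [-> | ->] : sgn = 1 \/ sgn = -1.
  by case: (eps); [right | left].
  by field; rewrite lam_neq0 siglam_neq0.
by field; rewrite lam_neq0 siglam_neq0.
Qed.

(* The rank-one terms [g v <., x0>] of [twist_num] and [g * twist_den] cancel,
   leaving [(twist s + g) R = (1 + (lam - 1) (g x0) <., g v>) (s + g)]. *)
Lemma det_twist_add :
  \det (twist s + g) = lam * sigma lam * \det (s + g).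
Proof.
have uR := unit_twist_den.
have eqR : (twist s + g) *m twist_den s =
    (1%:M + ((lam - 1) *: (g *m x0)) *m sform_row (g *m v)) *m (s + g).
  apply: mulmx_col_inj => y; rewrite -[LHS]mulmxA -[RHS]mulmxA mulmxDl twist_mul_den.
  rewrite twist_numE twist_denE !mulmxDl mul1mx mul_sform_row !mulmxDr.
  rewrite -!scalemxAr sformDl [sform (g *m y) _]isom_sform // scalerA.
  rewrite [sform y v + _]addrC [(_ + _) * (lam - 1)]mulrC addrA.
  by rewrite [_ - _ + _]addrAC subrK addrA.
have eq_det : \det (twist s + g) / sigma lam = lam * \det (s + g).
  rewrite -det_twist_den -det_mulmx eqR [LHS]det_mulmx det1Dmul -scalemxAr.
  by rewrite sform_rowE isom_sform // x0v !mxE eqxx mulr1n mulr1 addrC subrK.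
by rewrite mulrAC -eq_det divfK.
Qed.

Lemma twist_isom : twist s \in isom_grp sigma B.
Proof.
apply: sform_isom => x y; have uR := unit_twist_den.
rewrite -[x](mulKVmx uR) -[y](mulKVmx uR) !twist_mul_den twist_sform.
by rewrite !mulKVmx.
Qed.

(** Here [(x, - x)] is orthogonal to both [e] and [f], so the torus fixes it. *)
Lemma twist_fix x : s *m x = x -> sform x x0 = 0 ->
  sform x (v + g *m v) = 0 -> twist s *m x = x.
Proof.
move=> sx xx0 xv; have := twist_mul_den x.
rewrite twist_numE twist_denE sx xx0 -sformDr xv !mulr0 !scale0r.
by rewrite !addr0 subr0.
Qed.

(** On the orthogonal of [x0] the twist changes [s] only by multiples of [x0], which gives trivial
    action on [X^perp / X]. *)
Lemma twist_perp u : sform u x0 = 0 ->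
  twist s *m u = s *m u - alpha s u *: x0.
Proof.
move=> ux0; have := twist_mul_den u.
rewrite twist_numE twist_denE ux0 mulr0 !scale0r addr0 subr0.
set a := alpha s u => <-; rewrite mulmxDr -scalemxAr [twist s *m x0]twist_fix //.
  by rewrite addrK.
by rewrite sformDr x0v x0gv subrr.
Qed.
End Isometry.

(** The twist determines [s y] up to a multiple of [x0], and this multiple depends only on
    [<s y, g v>]. *)
Lemma twist_inj s1 s2 :
  s1 *m x0 = x0 -> s2 *m x0 = x0 -> twist s1 = twist s2 -> s1 = s2.
Proof.
move=> s1x0 s2x0 eq12; apply: mulmx_col_inj => y.
have fixx0 s : s *m x0 = x0 -> twist s *m x0 = x0.
  by move=> ?; rewrite twist_fix // sformDr x0v x0gv subrr.
have eqs s : s *m x0 = x0 ->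
    s *m y = twist s *m y + alpha s y *: x0 +
      (twist_coef * sform y x0) *: (twist s *m v + g *m v).
  move=> sx0; have := twist_mul_den sx0 y.
  rewrite twist_numE twist_denE !mulmxDr -!scalemxAr fixx0 //.
  by move/eqP; rewrite eq_sym subr_eq -addrA -scalerDr => /eqP.
have := eqs s1 s1x0; have := eqs s2 s2x0; rewrite -eq12.
set a := twist s1 *m y; set b := (_ * _) *: (_ + _).
set A1 := alpha s1 y; set A2 := alpha s2 y => e2 e1.
have d12 : s1 *m y - s2 *m y = (A1 - A2) *: x0.
  by rewrite e1 e2 opprD addrACA subrr addr0 opprD addrACA subrr add0r -scalerBl.
(* With [D = <s1 y - s2 y, g v>], pairing with [g v] gives [D = - (lam - 1) D], that is
   [lam * D = 0]. *)
have := congr1 (sform^~ (g *m v)) d12; rewrite /= -scaleN1r sformDl !sformZl x0gv.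
rewrite -mulrBr => h.
have : lam * (sform (s1 *m y) (g *m v) - sform (s2 *m y) (g *m v)) = 0.
  by move/eqP: h; rewrite -subr_eq0 => /eqP h; apply: etrans h; ring.
move/eqP; rewrite mulf_eq0 (negbTE lam_neq0) subr_eq0 /= => /eqP h0.
by apply/eqP; rewrite -subr_eq0 d12 /A1 /A2 h0 subrr scale0r.
Qed.
End Twist.
End SesquilinearForm.

(** * The nondegenerate form: parabolic, Levi factor and unipotent radical *)

Lemma unitmx_inj_row (F : fieldType) n (A : 'M[F]_n) :
  (forall u : 'rV_n, u *m A = 0 -> u = 0) -> A \in unitmx.
Proof.
move=> injA; rewrite -row_free_unit -kermx_eq0; apply/eqP/row_matrixP=> i.
by rewrite row0; apply: injA; apply/sub_kermxP/row_sub.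
Qed.

Section NonDegenerateForm.
Variables (E : finFieldType) (sigma : {rmorphism E -> E}) (eps : bool).
Variables (k m : nat) (Cxy : 'M[E]_k) (B0 : 'M[E]_m).
Local Notation B := (form_nd sigma eps Cxy B0).
Local Notation G := (isom_grp sigma B).
Local Notation P := (parab_nd sigma B).
Hypothesis sigmaK : forall x, sigma (sigma x) = x.
Hypothesis symB : sesq_form sigma eps B.
Hypothesis unitB : B \in unitmx.

Lemma form_nd_unitC : Cxy \in unitmx.
Proof.
apply: unitmx_inj_row => u uC.
have : row_mx (row_mx u 0) 0 *m B = 0.
  rewrite mul_row_block !mul0mx !addr0 mul_row_block mul_row_col.
  by rewrite uC !mul0mx !mulmx0 !addr0 !row_mx0.
move/(congr1 (mulmx^~ (invmx B))); rewrite mulmxK // mul0mx => /eqP.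
by rewrite row_mx_eq0 row_mx_eq0 => /andP[/andP[/eqP]].
Qed.

Lemma form_nd_unitB0 : B0 \in unitmx.
Proof.
apply: unitmx_inj_row => u uB.
have : row_mx (row_mx 0 u) 0 *m B = 0.
  rewrite mul_row_block !mul0mx !addr0 mul_row_block mul_row_col.
  by rewrite uB !mul0mx !mulmx0 !addr0 !row_mx0.
move/(congr1 (mulmx^~ (invmx B))); rewrite mulmxK // mul0mx => /eqP.
by rewrite row_mx_eq0 row_mx_eq0 => /andP[/andP[_ /eqP]].
Qed.

(** The columns are a basis of [X], whose vectors are thus the [Xmx *m c]; membership in [X^perp]
    reads [dsubmx y = 0]. *)
Definition Xmx : 'M[E]_(k + m + k, k) := col_mx (col_mx 1%:M 0) 0.

Lemma XmxE n (c : 'M[E]_(k, n)) : Xmx *m c = col_mx (col_mx c 0) 0.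
Proof. by rewrite !mul_col_mx mul1mx !mul0mx. Qed.

Lemma trXmx_form : Xmx^T *m B = row_mx 0 Cxy.
Proof.
rewrite !tr_col_mx trmx1 !trmx0 mul_row_block !mul0mx !addr0.
by rewrite mul_row_block mul_row_col !mul0mx !mulmx0 !mul1mx !addr0 row_mx0.
Qed.

Lemma sform_Xmx c y :
  sform sigma B (Xmx *m c) y = (c^T *m (Cxy *m map_mx sigma (dsubmx y))) 0 0.
Proof.
rewrite /sform trmx_mul -(mulmxA c^T) trXmx_form -mulmxA.
by rewrite -{1}[y]vsubmxK map_col_mx mul_row_col mul0mx add0r.
Qed.

Lemma sform_Xmx_perp c y : dsubmx y = 0 -> sform sigma B (Xmx *m c) y = 0.
Proof. by move=> y0; rewrite sform_Xmx y0 map_mx0 !mulmx0 mxE. Qed.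

Lemma parab_ndP p : reflect
  [/\ p \in G, dlsubmx p = 0 & dlsubmx (ulsubmx p) = 0] (p \in P).
Proof.
rewrite [p \in P]inE.
by apply: (iffP and3P) => -[? /eqP ? /eqP ?].
Qed.

Lemma isom_dlsub0_ul p : p \in G -> dlsubmx p = 0 ->
  (ulsubmx p)^T *m block_mx 0 0 0 B0 *m map_mx sigma (ulsubmx p) =
    block_mx 0 0 0 B0.
Proof.
case/isom_grpP=> _ ep p0; have := congr1 ulsubmx ep.
rewrite -{1 2}[p]submxK p0 tr_block_mx map_block_mx trmx0 map_mx0.
by rewrite !mulmx_block !block_mxKul !mulmx0 !mul0mx !addr0.
Qed.

(** An isometry stabilising [X^perp] also stabilises the radical of the form restricted to it, which
    is [X] because [B0] is invertible. *)
Lemma isom_parab_nd p : p \in G -> dlsubmx p = 0 -> p \in P.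
Proof.
move=> Gp p0; apply/parab_ndP; split=> //.
have /isom_grpP[up _] := Gp.
have uU : map_mx sigma (ulsubmx p) \in unitmx.
  by rewrite map_unitmx; move: up; rewrite unitmx_dlsub0 // => /andP[].
have := congr1 (mulmx^~ (invmx (map_mx sigma (ulsubmx p)))) (isom_dlsub0_ul Gp p0).
rewrite mulmxK // => /(congr1 ursubmx).
rewrite -{1}[ulsubmx p]submxK tr_block_mx mulmx_block block_mxKur mulmx0 add0r.
rewrite -[invmx _]submxK mulmx_block block_mxKur !mul0mx addr0.
move/(congr1 (mulmx^~ (invmx B0))); rewrite mulmxK ?form_nd_unitB0 // mul0mx.
by move/(congr1 trmx); rewrite trmxK trmx0.
Qed.

Lemma parab_nd_levi p : p \in P ->
  (ulsubmx (ulsubmx p) \in unitmx) /\ (drsubmx (ulsubmx p) \in isom_grp sigma B0).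
Proof.
case/parab_ndP=> Gp p0 p00; have /isom_grpP[up _] := Gp.
move: up; rewrite unitmx_dlsub0 // => /andP[]; rewrite unitmx_dlsub0 //.
case/andP=> ua ub _; split=> //; apply/isom_grpP; split=> //.
have := congr1 drsubmx (isom_dlsub0_ul Gp p0).
rewrite -{1 2}[ulsubmx p]submxK p00 tr_block_mx map_block_mx trmx0 map_mx0.
by rewrite !mulmx_block !block_mxKdr !mulmx0 !add0r mul0mx add0r.
Qed.

Lemma levi_nd a h : a \in unitmx -> h \in isom_grp sigma B0 ->
  exists2 p, p \in P &
    ulsubmx (ulsubmx p) = a /\ drsubmx (ulsubmx p) = h.
Proof.
move=> ua /isom_grpP[uh eh]; have uC := form_nd_unitC.
(* The action on [Y] is forced by duality with [X]: [a^T Cxy (sigma d) = Cxy]. *)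
pose d := map_mx sigma (invmx Cxy *m invmx a^T *m Cxy).
have sd : map_mx sigma d = invmx Cxy *m invmx a^T *m Cxy.
  by apply/matrixP=> i j; rewrite !mxE sigmaK.
have ud : d \in unitmx.
  by rewrite map_unitmx !unitmx_mul !unitmx_inv uC unitmx_tr ua.
pose p : 'M[E]_(k + m + k) := block_mx (block_mx a 0 0 h) 0 0 d.
have aCd : a^T *m Cxy *m map_mx sigma d = Cxy.
  rewrite sd !mulmxA mulmxK // mulmxV ?mul1mx // unitmx_tr //.
have dCa : d^T *m (map_mx sigma Cxy)^T *m map_mx sigma a = (map_mx sigma Cxy)^T.
  have := congr1 (fun M => (map_mx sigma M)^T) aCd.
  rewrite !map_mxM !trmx_mul -!map_trmx trmxK mulmxA.
  suff -> : map_mx sigma (map_mx sigma d) = d by [].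
  by apply/matrixP=> i j; rewrite !mxE sigmaK.
exists p; last by rewrite /p !block_mxKul block_mxKdr.
apply/parab_ndP; rewrite /p block_mxKdl !block_mxKul block_mxKdl; split=> //.
apply/isom_grpP; split.
  rewrite unitmx_dlsub0 ?block_mxKdl // block_mxKul block_mxKdr.
  by rewrite unitmx_dlsub0 ?block_mxKdl // block_mxKul block_mxKdr ua uh ud.
rewrite !tr_block_mx !map_block_mx !trmx0 !map_mx0 /form_nd.
rewrite !mulmx_block !mulmx0 !mul0mx !addr0 !add0r.
rewrite mulmx_block mul_block_col !mulmx0 !mul0mx !addr0 !add0r eh.
rewrite mul_col_mx mul0mx aCd.
rewrite mul_mx_row mulmx0 mul_row_block !mulmx0 !mul0mx !addr0.
by rewrite -scalemxAr -scalemxAl dCa.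
Qed.

Lemma parab_nd_mul p q : p \in P -> q \in P ->
  [/\ p *m q \in P, ulsubmx (ulsubmx (p *m q)) =
        ulsubmx (ulsubmx p) *m ulsubmx (ulsubmx q) &
      drsubmx (ulsubmx (p *m q)) =
        drsubmx (ulsubmx p) *m drsubmx (ulsubmx q)].
Proof.
case/parab_ndP=> Gp p0 p00 /parab_ndP[Gq q0 q00].
have [_ _ mG] := isom_grp_group sigma B.
have [ul dl dr] := mul_ublock p0 q0; have [ul' dl' dr'] := mul_ublock p00 q00.
by split; [apply/parab_ndP; rewrite mG // ul | rewrite ul | rewrite ul].
Qed.

Lemma parab_nd_group : mx_group P.
Proof.
have [G1 uG _] := isom_grp_group sigma B.
have [u1 d1 e1] := blocks_mx1 E (k + m) k; have [u1' d1' e1'] := blocks_mx1 E k m.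
split=> [|p /parab_ndP[/uG]//|p q Pp Pq]; last by have [] := parab_nd_mul Pp Pq.
by apply/parab_ndP; rewrite u1 d1 d1'.
Qed.

Definition unip_nd : {set 'M[E]_(k + m + k)} :=
  [set u in P | (ulsubmx (ulsubmx u) == 1%:M) && (drsubmx (ulsubmx u) == 1%:M)].

Lemma unip_ndP u : reflect
  [/\ u \in P, ulsubmx (ulsubmx u) = 1%:M & drsubmx (ulsubmx u) = 1%:M]
  (u \in unip_nd).
Proof.
rewrite [u \in unip_nd]inE.
by apply: (iffP and3P) => -[? /eqP ? /eqP ?].
Qed.

Lemma unip_nd_group : mx_group unip_nd.
Proof.
have [P1 uP _] := parab_nd_group.
have [u1 d1 e1] := blocks_mx1 E (k + m) k; have [u1' d1' e1'] := blocks_mx1 E k m.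
split=> [|p /unip_ndP[/uP]//|p q /unip_ndP[Pp pa pb] /unip_ndP[Pq qa qb]].
  by apply/unip_ndP; rewrite u1 u1' e1'.
have [Ppq ul dr] := parab_nd_mul Pp Pq.
by apply/unip_ndP; rewrite ul dr pa pb qa qb !mulmx1.
Qed.

Lemma unip_nd_fix u : u \in unip_nd -> u *m Xmx = Xmx.
Proof.
case/unip_ndP=> /parab_ndP[_ u0 u00] ua ub.
rewrite /Xmx -{1}[u]submxK u0 mul_block_col !mulmx0 !mul0mx !addr0.
by rewrite -[ulsubmx u]submxK u00 ua mul_block_col !mulmx0 !mul0mx !addr0 mulmx1.
Qed.

Lemma unip_nd_perp u (y : 'cV_(k + m + k)) : u \in unip_nd -> dsubmx y = 0 ->
  exists c, u *m y = y + Xmx *m c.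
Proof.
case/unip_ndP=> /parab_ndP[_ u0 u00] ua ub y0.
exists (ursubmx (ulsubmx u) *m dsubmx (usubmx y)); rewrite XmxE.
rewrite -{1 2}[y]vsubmxK -{1}[u]submxK u0 y0 mul_block_col !mulmx0 !mul0mx !addr0.
rewrite -{1 2}[usubmx y]vsubmxK -{1}[ulsubmx u]submxK u00 ua ub mul_block_col.
by rewrite !mul0mx !mul1mx add0r !add_col_mx !addr0.
Qed.

(** The unipotent radical consists of the isometries acting trivially on [X] and on [X^perp / X], a
    criterion that can be tested on a twist. *)
Lemma in_unip_nd u : u \in G -> u *m Xmx = Xmx ->
  (forall y : 'cV_(k + m + k), dsubmx y = 0 ->
     exists c, u *m y = y + Xmx *m c) -> u \in unip_nd.
Proof.
move=> Gu uX uy.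
have {}uy (y : 'cV_(k + m)) :
    dlsubmx u *m y = 0 /\ dsubmx (ulsubmx u *m y) = dsubmx y.
  have [|c] := uy (col_mx y 0); first by rewrite col_mxKd.
  rewrite XmxE -{1}[u]submxK mul_block_col !mulmx0 !addr0 add_col_mx addr0.
  case/eq_col_mx=> -> ->; split=> //.
  by rewrite -{1}[y]vsubmxK add_col_mx col_mxKd addr0.
have u0 : dlsubmx u = 0.
  by apply: mulmx_col_inj => y; have [-> _] := uy y; rewrite mul0mx.
have uPP := isom_parab_nd Gu u0; have /parab_ndP[_ _ u00] := uPP.
apply/unip_ndP; split=> //.
  move: uX; rewrite /Xmx -{1}[u]submxK mul_block_col !mulmx0 !addr0.
  case/eq_col_mx=> + _; rewrite -{1}[ulsubmx u]submxK mul_block_col.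
  by rewrite !mulmx0 !addr0 mulmx1 => /eq_col_mx[].
apply: mulmx_col_inj => y; have [_] := uy (col_mx 0 y).
rewrite -{1}[ulsubmx u]submxK mul_block_col !mulmx0 !add0r !col_mxKd => ->.
by rewrite mul1mx.
Qed.

(** The action on [V / X^perp] is dual to the trivial action on [X], so all three diagonal blocks
    are identities. *)
Lemma det_unip_nd u : u \in unip_nd -> \det u = 1.
Proof.
move=> Nu; have /unip_ndP[/parab_ndP[/isom_grpP[_ eu] u0 u00] ua ub] := Nu.
suff udr : drsubmx u = 1%:M.
  by rewrite det_dlsub0 // udr det_dlsub0 // ua ub !det1 !mulr1.
have := congr1 (mulmx Xmx^T) eu; rewrite !mulmxA -trmx_mul unip_nd_fix //.
rewrite trXmx_form -{1}[u]submxK map_block_mx mul_row_block !mul0mx !add0r.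
case/eq_row_mx=> _ /(congr1 (mulmx (invmx Cxy))).
rewrite mulKmx ?form_nd_unitC // mulVmx ?form_nd_unitC // => sdr.
apply/matrixP=> i j; have /matrixP/(_ i j) := sdr.
rewrite !mxE => /(congr1 sigma); rewrite sigmaK => ->.
by case: (i == j); rewrite ?rmorph1 ?rmorph0.
Qed.

Section Character.
Variables (C : fieldType) (chi : E -> C).
Hypothesis chiM : forall x y, x != 0 -> y != 0 -> chi (x * y) = chi x * chi y.
Variable lam : E.
Hypotheses (lam_neq0 : lam != 0) (chi_lam : chi (lam * sigma lam) != 1).

Lemma sum_unip_nd_chi0 g : g \in G -> g \notin P ->
  \sum_(s in unip_nd) chi0 chi (\det (s + g)) = 0.
Proof.
move=> Gg nPg.
have [[Z /dlsubmx_row0_1 g0]|[v []]] :=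
  unstable_kernel_witness (row_mx (0 : 'M_(k, k + m)) 1%:M) g.
  by case/negP: nPg; exact: isom_parab_nd.
rewrite !mulmx_row0_1 => gv0 v_neq0.
(* The last block of [v] is nonzero and [Cxy] is invertible, so some vector of [X] pairs to 1 with
   [v]. *)
have [w wv] : exists w : 'rV_k, (w *m (Cxy *m map_mx sigma (dsubmx v))) 0 0 = 1.
  apply: exists_mulmx_eq; apply: contra v_neq0 => /eqP Cv0.
  rewrite -(map_mx_eq0 sigma) -(mulKmx form_nd_unitC (map_mx _ _)) Cv0.
  by rewrite mulmx0.
pose x0 := Xmx *m w^T.
have Xperp c : dsubmx (Xmx *m c : 'cV_(k + m + k)) = 0 by rewrite XmxE col_mxKd.
have x00 : sform sigma B x0 x0 = 0 by exact: sform_Xmx_perp (Xperp _).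
have x0v : sform sigma B x0 v = 1 by rewrite sform_Xmx trmxK.
have Xgv c : sform sigma B (Xmx *m c) (v + g *m v) = 0 by rewrite sform_Xmx_perp.
have x0gv : sform sigma B x0 (g *m v) = -1.
  by apply/eqP; rewrite -addr_eq0 addrC -x0v -sformDr Xgv.
have perpX y c : dsubmx y = 0 -> sform sigma B y (Xmx *m c) = 0.
  by move=> y0; rewrite (sformC sigmaK symB) sform_Xmx_perp // rmorph0 mulr0.
have NG s : s \in unip_nd -> s \in G by case/unip_ndP=> /parab_ndP[].
have Nx0 s : s \in unip_nd -> s *m x0 = x0.
  by move=> Ns; rewrite mulmxA unip_nd_fix.
have ll0 : lam * sigma lam != 0 by rewrite mulf_neq0 // fmorph_eq0.
apply: (sum_chi0_twist chiM (phi := twist sigma eps B g x0 v lam) ll0 chi_lam).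
(* [X] is orthogonal to [x0] and to [v + g v], so [twist_fix] applies to it; on [X^perp],
   [twist_perp] adds only a vector of [X]. *)
- move=> s Ns; apply: in_unip_nd.
  + exact: twist_isom (NG _ Ns) (Nx0 _ Ns).
  + apply: mulmx_col_inj => c; rewrite -mulmxA.
    apply: twist_fix => //; first exact: Nx0.
      by rewrite mulmxA unip_nd_fix.
    by rewrite perpX.
  move=> y y0; have [c sy] := unip_nd_perp Ns y0.
  have yx0 : sform sigma B y x0 = 0 by exact: perpX.
  rewrite (twist_perp sigmaK symB lam_neq0 x00 x0v x0gv (Nx0 _ Ns) yx0) sy.
  set a := (_ * _); exists (c - a *: w^T).
  by rewrite mulmxBr -scalemxAr addrA.
- move=> s1 s2 N1 N2; by apply: twist_inj; rewrite ?Nx0.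
by move=> s Ns; apply: det_twist_add; rewrite ?Nx0.
Qed.
End Character.

Lemma J_op_ind_scalar_nd (C : closedFieldType) (sq : C) (chi : E -> C) lam
    dt dp (tau : 'M[E]_k -> 'M[C]_dt) (pi0 : 'M[E]_m -> 'M[C]_dp)
    r (t : 'I_r -> 'M[E]_(k + m + k)) :
  (forall x y, x != 0 -> y != 0 -> chi (x * y) = chi x * chi y) ->
  lam != 0 -> chi (lam * sigma lam) != 1 ->
  irr_rep (GL_set E k) tau -> irr_rep (isom_grp sigma B0) pi0 ->
  left_transversal G P t ->
  exists a : C, J_op sigma sq chi eps B (ind_rep P (infl_nd tau pi0) t) = a%:M.
Proof.
move=> chiM lam0 chi_lam irr_tau irr_pi t_trans.
have [[tau1 tauM] _ _] := irr_tau; have [[pi1 piM] _ _] := irr_pi.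
have sPG : P \subset G by apply/subsetP=> p /parab_ndP[].
have sNP : unip_nd \subset P by apply/subsetP=> p /unip_ndP[].
have infl1 : {in unip_nd, forall u, infl_nd tau pi0 u = 1%:M}.
  by move=> u /unip_ndP[_ ul dr]; rewrite /infl_nd ul dr tau1 pi1 tensmx11.
rewrite J_opE; have [|||a ->] := sum_ind_rep_scalar (s := infl_nd tau pi0)
  (isom_grp_group sigma B) parab_nd_group unip_nd_group sPG sNP
  (J_coef_class chi eps (B := B)) _ infl1 _ _ t_trans.
- split; first by have [N1 _ _] := unip_nd_group; exact: infl1.
  move=> p q Pp Pq; have [ua hb] := parab_nd_levi Pp.
  have [va hc] := parab_nd_levi Pq; have [_ ul dr] := parab_nd_mul Pp Pq.
  by rewrite /infl_nd ul dr tauM ?piM ?tensmx_mul // inE.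
- move=> g Gg nPg; apply: sum_J_coef_translate => //.
  + exact: unip_nd_group.
  + exact: subset_trans sNP sPG.
  + by move=> u; exact: det_unip_nd.
  exact: sum_unip_nd_chi0 chiM _ lam0 chi_lam _ Gg nPg.
- move=> T cT; apply: (tens_irr_commutant irr_tau irr_pi).
  + by rewrite inE unitmx1.
  + by have [] := isom_grp_group sigma B0.
  (* Each pair in the Levi factor lifts to [P], so commuting with the inflated representation is
     commuting with the whole tensor product. *)
  move=> a b; rewrite inE => ua hb; have [p Pp [pa pb]] := levi_nd ua hb.
  by have := cT p Pp; rewrite /infl_nd pa pb.
by eexists; rewrite scale_scalar_mx.
Qed.
End NonDegenerateForm.

Theorem mainTheorem7
  (E : finFieldType) (sigma : {rmorphism E -> E})
  (C : closedFieldType) (sq : C) (chi : E -> C) (eps : bool) :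
  (* x |-> xbar is an involution of E; F = its fixed field, q = #|F| odd *)
  (forall x : E, sigma (sigma x) = x) ->
  odd (qF sigma) ->
  (* char C does not divide q; sq is the fixed square root of q *)
  (qF sigma)%:R != 0 :> C ->
  sq ^+ 2 = (qF sigma)%:R ->
  (* eps_V = 1 if E <> F *)
  (~~ E_is_F sigma -> eps = false) ->
  (* chi : E^x -> C^x is a character *)
  (forall x y : E, x != 0 -> y != 0 -> chi (x * y) = chi x * chi y) ->
  (forall x : E, x != 0 -> chi x != 0) ->
  (* chi^{1+q} <> 1 *)
  (exists x : E, x != 0 /\ chi (x * sigma x) != 1) ->
  (* nondegenerate case *)
  (forall (k m : nat) (Cxy : 'M[E]_k) (B0 : 'M[E]_m)
          (dt dp : nat) (tau : 'M[E]_k -> 'M[C]_dt) (pi0 : 'M[E]_m -> 'M[C]_dp)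
          (r : nat) (t : 'I_r -> 'M[E]_(k + m + k)),
     let B := form_nd sigma eps Cxy B0 in
     sesq_form sigma eps B ->
     B \in unitmx ->
     irr_rep (GL_set E k) tau ->
     irr_rep (isom_grp sigma B0) pi0 ->
     left_transversal (isom_grp sigma B) (parab_nd sigma B) t ->
     exists a : C,
       J_op sigma sq chi eps B
         (ind_rep (parab_nd sigma B) (infl_nd tau pi0) t) = a%:M)
  /\
  (* zero form case *)
  (forall (k m : nat)
          (dt dp : nat) (tau : 'M[E]_k -> 'M[C]_dt) (pi0 : 'M[E]_m -> 'M[C]_dp)
          (r : nat) (t : 'I_r -> 'M[E]_(k + m)),
     irr_rep (GL_set E k) tau ->
     irr_rep (isom_grp sigma (0 : 'M[E]_m)) pi0 ->
     left_transversal (isom_grp sigma (0 : 'M[E]_(k + m))) (parab_z sigma k m) t ->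
     exists a : C,
       J_op sigma sq chi eps (0 : 'M[E]_(k + m))
         (ind_rep (parab_z sigma k m) (infl_z tau pi0) t) = a%:M).
Proof.
move=> sigmaK _ _ _ _ chiM _ [lam [lam0 chi_lam]]; split.
  move=> k m Cxy B0 dt dp tau pi0 r t B symB unitB irr_tau irr_pi t_trans.
  exact: J_op_ind_scalar_nd chi_lam irr_tau irr_pi t_trans.
move=> k m dt dp tau pi0 r t irr_tau irr_pi t_trans.
(* For the zero form the determinant can be scaled by any nonzero scalar; [lam * sigma lam] is one
   on which [chi] is not 1. *)
have c0 : lam * sigma lam != 0 by rewrite mulf_neq0 // fmorph_eq0.
exact: J_op_ind_scalar_z c0 chi_lam irr_tau irr_pi t_trans.
Qed.
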